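(* Let $X,Y$ be finite, $\mu,\nu$ with full support, $c:X\times Y\to\mathbb{R}$, $\varepsilon>0$, and let $\varphi_1,\varphi_2$ be entropy functions each of which is non-negative, finite on $[0,\infty)$, and continuously differentiable on the interior of its domain. Let $\{X_i\}_{i\in I}$ be a basic partition of $X$, let $\mathcal{J}_A,\mathcal{J}_B$ be two composite partitions, and let $\pi_{\mathrm{init}}\in\mathcal{M}_+(X\times Y)$ be feasible, i.e. $E(\pi_{\mathrm{init}})<\infty$. Assume that the weight function $\mathrm{GetWeights}$ 1. is continuous, and 2. for every plan $\pi\in\mathcal{M}_+(X\times Y)$, every composite partition $\mathcal{J}$, current cell plans $(\pi_J)_{J\in\mathcal{J}}$ with $\pi_J=\pi\llcorner(X_J\times Y)$, and new cell plans $(\tilde\pi_J)_{J\in\mathcal{J}}=(S_J(\pi))_{J\in\mathcal{J}}$, the updated plan $$\bar\pi=\sum_{J\in\mathcal{J}}(1-\theta_J)\pi_J+\theta_J\tilde\pi_J,\qquad (\theta_J)_J=\mathrm{GetWeights}((\pi_J)_J,(\tilde\pi_J)_J),$$ satisfies $E(\bar\pi)<E(\pi)$, unless $\pi_J=\tilde\pi_J$ for all $J\in\mathcal{J}$ (in which case $\pi$ is already optimal). Then the sequence $(\pi^k)_k$ generated by the parallel unbalanced domain decomposition algorithm with weight function $\mathrm{GetWeights}$ (defined in the context), started from $\pi^0=\pi_{\mathrm{init}}$, converges to the globally optimal solution of $$\inf_{\pi\in\mathcal{M}_+(X\times Y)}E(\pi).$$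
   Context: $\mathcal{M}_+(Z)$ denotes the non-negative finite measures on $Z$. $\langle\phi,\rho\rangle$ is the integral of $\phi$ against $\rho$; $\pi\llcorner S$ is the restriction of $\pi$ to $S$. $\mathrm{P}_X,\mathrm{P}_Y$ are the marginal projections: $(\mathrm{P}_X\pi)(A)=\pi(A\times Y)$, $(\mathrm{P}_Y\pi)(B)=\pi(X\times B)$. $\mu\in\mathcal{M}_+(X)$, $\nu\in\mathcal{M}_+(Y)$. An entropy function is a lower semicontinuous convex function $\varphi:\mathbb{R}\to\mathbb{R}\cup\{\infty\}$ with $\mathrm{dom}(\varphi)\subseteq[0,\infty)$ and $\mathrm{dom}(\varphi)\setminus\{0\}\neq\emptyset$. Set $\varphi'_\infty=\lim_{x\to+\infty}\varphi(x)/x$. The associated divergence is $D_\varphi(\rho\mid\sigma)=\int_Z\varphi\left(\frac{\mathrm{d}\rho}{\mathrm{d}\sigma}\right)\mathrm{d}\sigma+\varphi'_\infty\,\rho^\perp(Z)$, where $\rho=\frac{\mathrm{d}\rho}{\mathrm{d}\sigma}\sigma+\rho^\perp$ is the Lebesgue decomposition. Write $D_1=D_{\varphi_1}$, $D_2=D_{\varphi_2}$. For $\rho\ll\sigma$, $\mathrm{KL}(\rho\mid\sigma)=\int\left[\frac{\mathrm{d}\rho}{\mathrm{d}\sigma}\log\frac{\mathrm{d}\rho}{\mathrm{d}\sigma}-\frac{\mathrm{d}\rho}{\mathrm{d}\sigma}+1\right]\mathrm{d}\sigma$ (with $0\log 0=0$), and $+\infty$ otherwise. Global objective (score): $$E(\pi)=\langle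 c,\pi\rangle+\varepsilon\,\mathrm{KL}(\pi\mid\mu\otimes\nu)+D_1(\mathrm{P}_X\pi\mid\mu)+D_2(\mathrm{P}_Y\pi\mid\nu).$$ A basic partition $\{X_i\}_{i\in I}$ ($I$ finite) is a partition of $X$ into closed, $\mu$-essentially disjoint subsets with $\mu(X_i)>0$ for all $i$. A composite partition $\mathcal{J}$ is a partition of $I$; for $J\in\mathcal{J}$ the composite cell is $X_J=\bigcup_{i\in J}X_i$ and $\mu_J=\mu\llcorner X_J$. Cell objective, for $\nu_{-J}\in\mathcal{M}_+(Y)$ and $\pi_J\in\mathcal{M}_+(X_J\times Y)$: $$E_J(\pi_J\mid\nu_{-J})=\langle c,\pi_J\rangle+\varepsilon\,\mathrm{KL}(\pi_J\mid\mu_J\otimes\nu)+D_1(\mathrm{P}_X\pi_J\mid\mu_J)+D_2(\mathrm{P}_Y\pi_J+\nu_{-J}\mid\nu).$$ In this setting it has a unique minimizer over $\mathcal{M}_+(X_J\times Y)$. The cell solution map is $$S_J(\pi)=\operatorname*{argmin}_{\hat\pi_J\in\mathcal{M}_+(X_J\times Y)}E_J\left(\hat\pi_J\,\middle|\,\mathrm{P}_Y[\pi\llcorner((X\setminus X_J)\times Y)]\right).$$ A weight function $\mathrm{GetWeights}$ assigns, for each composite partition $\mathcal{J}$, to a pair of families $(\pi_J)_{J\in\mathcal{J}},(\tilde\pi_J)_{J\in\mathcal{J}}$ with $\pi_J,\tilde\pi_J\in\mathcal{M}_+(X_J\times Y)$ a vector $(\theta_J)_{J\in\mathcal{J}}\in[0,1]^{\mathcal{J}}$.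 Parallel unbalanced domain decomposition algorithm with weight function $\mathrm{GetWeights}$: set $\pi^0=\pi_{\mathrm{init}}$. For $k=1,2,\dots$, let $\mathcal{J}=\mathcal{J}_A$ if $k$ is odd and $\mathcal{J}=\mathcal{J}_B$ if $k$ is even. For all $J\in\mathcal{J}$ set $\pi_J=\pi^{k-1}\llcorner(X_J\times Y)$ and $\tilde\pi_J=S_J(\pi^{k-1})$. Compute $(\theta_J)_J=\mathrm{GetWeights}((\pi_J)_J,(\tilde\pi_J)_J)$ and set $\pi^k=\sum_{J\in\mathcal{J}}(1-\theta_J)\pi_J+\theta_J\tilde\pi_J$. *)

(* Defs.v *)
From mathcomp Require Import all_boot all_order all_algebra.
From mathcomp Require Import all_classical all_reals all_analysis.

Set Implicit Arguments.
Unset Strict Implicit.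
Unset Printing Implicit Defensive.
Import Order.TTheory GRing.Theory Num.Theory.
Import numFieldNormedType.Exports.

Local Open Scope classical_set_scope.
Local Open Scope ring_scope.

(* A measure on a finite (discrete) space Z is represented by its point
   masses, i.e. by a function Z -> R; integrals are then finite sums, and
   convergence of measures is pointwise convergence, the topology of
   {ptws Z -> R}. *)
Section Measures.
Context {R : realType} {Z : finType}.
Implicit Types (rho sigma : Z -> R).

Definition measures : set (Z -> R) := [set rho | forall z, 0 <= rho z].

(* measures of Z concentrated on A, i.e. the measures on the subspace A *)
Definition measures_on (A : {pred Z}) : set (Z -> R) :=
  [set rho | measures rho /\ forall z, z \notin A -> rho z = 0].

Definition full_support rho := forall z, 0 < rho z.

Definition mass rho (A : {pred Z}) : R := \sum_(z in A) rho z.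

Definition pairing (f : Z -> R) rho : R := \sum_z f z * rho z.

Definition restriction rho (A : {pred Z}) : Z -> R :=
  fun z => if z \in A then rho z else 0.

(* Lebesgue decomposition: rho = density rho sigma * sigma + singular rho sigma.
   Where sigma z = 0 the density is 0, as r / 0 = 0. *)
Definition density rho sigma : Z -> R := fun z => rho z / sigma z.

Definition singular rho sigma : Z -> R :=
  fun z => if sigma z == 0 then rho z else 0.

Definition abs_continuous rho sigma := forall z, sigma z = 0 -> rho z = 0.

(* 0 log 0 = 0 holds because of the factor 0 *)
Definition KL rho sigma : \bar R :=
  if `[< abs_continuous rho sigma >] then
    (\sum_z (density rho sigma z * ln (density rho sigma z)
             - density rho sigma z + 1) * sigma z)%:E
  else +oo%E.

End Measures.

Section Entropy.
Context {R : realType}.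
Implicit Type phi : R -> \bar R.

(* phi takes values in R u {+oo}: -oo is excluded in [entropy_function] *)
Definition edom phi : set R := [set x | (phi x < +oo)%E].

Definition econvex phi := forall (x y t : R), 0 <= t <= 1 ->
  (phi (t * x + (1 - t) * y)%R <= t%:E * phi x + (1 - t)%:E * phi y)%E.

Definition entropy_function phi :=
  [/\ forall x, phi x != -oo%E,
      lower_semicontinuous phi,
      econvex phi,
      edom phi `<=` [set x | 0 <= x]
    & edom phi `\ 0 !=set0].

(* phi'_oo; the limit exists for an entropy function *)
Definition recession phi : \bar R := lim ((phi x * (x^-1)%:E)%E @[x --> +oo]).

Definition divergence (Z : finType) phi (rho sigma : Z -> R) : \bar R :=
  ((\sum_(z : Z) phi (density rho sigma z) * (sigma z)%:E)
   + recession phi * (\sum_z singular rho sigma z)%:E)%E.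

Definition C1_on_interior phi := forall x : R, (edom phi)° x ->
  derivable (fine \o phi) x 1 /\ {for x, continuous (derive1 (fine \o phi))}.

End Entropy.

Definition argmin (T : Type) (R : realType) (A : set T) (f : T -> \bar R)
  : set T := [set a | A a /\ forall b, A b -> (f a <= f b)%E].

Section Problem.
Context {R : realType} {X Y : finType}.

Definition plan := {ptws X * Y -> R}.

Definition margX (pi : X * Y -> R) : X -> R := fun x => \sum_y pi (x, y).
Definition margY (pi : X * Y -> R) : Y -> R := fun y => \sum_x pi (x, y).

Definition prod_meas (mu : X -> R) (nu : Y -> R) : X * Y -> R :=
  fun p => mu p.1 * nu p.2.

Definition cylinder (A : {set X}) : {pred X * Y} := [pred p | p.1 \in A].

Context (mu : X -> R) (nu : Y -> R) (c : X * Y -> R) (eps : R).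
Context (phi1 phi2 : R -> \bar R).

Definition score (pi : X * Y -> R) : \bar R :=
  ((pairing c pi)%:E + eps%:E * KL pi (prod_meas mu nu)
   + divergence phi1 (margX pi) mu + divergence phi2 (margY pi) nu)%E.

Context {I : finType} (Xc : I -> {set X}).

(* The requirement that the cells be closed is void: X is finite, discrete. *)
Definition basic_partition :=
  [/\ forall x, exists i, x \in Xc i,
      forall i j, i != j -> mass mu (Xc i :&: Xc j)%SET = 0
    & forall i, 0 < mass mu (Xc i)].

Definition composite_partition (P : {set {set I}}) : bool :=
  finset.partition P [set: I]%SET.

Definition composite_cell (J : {set I}) : {set X} := (\bigcup_(i in J) Xc i)%SET.

Definition cell_score (J : {set I}) (nu_mJ : Y -> R) (piJ : X * Y -> R)
    : \bar R :=
  let muJ := restriction mu (composite_cell J) in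
  ((pairing c piJ)%:E + eps%:E * KL piJ (prod_meas muJ nu)
   + divergence phi1 (margX piJ) muJ
   + divergence phi2 (fun y => margY piJ y + nu_mJ y)%R nu)%E.

(* [xget] picks an element of the argmin set, with default value 0 if there
   is none. *)
Definition cell_solution (J : {set I}) (pi : X * Y -> R) : plan :=
  xget (fun=> 0 : R)
    (argmin (measures_on (cylinder (composite_cell J)))
       (cell_score J
          (margY (restriction pi (cylinder (~: composite_cell J)%SET))))).

(* families (pi_J)_{J in P} of plans, with the product topology *)
Definition plan_family (P : {set {set I}}) :=
  {ptws {J : {set I} | J \in P} -> plan}.

Definition weights (P : {set {set I}}) :=
  {ptws {J : {set I} | J \in P} -> R}.

Definition cell_families (P : {set {set I}}) : set (plan_family P) :=
  [set f | forall J, measures_on (cylinder (composite_cell (val J))) (f J)].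

Context (GetWeights : forall P : {set {set I}},
  plan_family P -> plan_family P -> weights P).

Definition weight_function := forall P, composite_partition P ->
  forall f g : plan_family P, cell_families f -> cell_families g ->
  forall J, 0 <= GetWeights f g J <= 1.

Definition weights_continuous := forall P, composite_partition P ->
  {within [set fg : plan_family P * plan_family P |
             cell_families fg.1 /\ cell_families fg.2],
    continuous (fun fg : plan_family P * plan_family P =>
                  GetWeights fg.1 fg.2)}.

Definition current_cells (P : {set {set I}}) (pi : X * Y -> R)
    : plan_family P :=
  fun J => restriction pi (cylinder (composite_cell (val J))).

Definition new_cells (P : {set {set I}}) (pi : X * Y -> R) : plan_family P :=
  fun J => cell_solution (val J) pi.

Definition update (P : {set {set I}}) (pi : X * Y -> R) : plan :=
  let piJ := current_cells (P := P) pi in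
  let piJ' := new_cells (P := P) pi in
  let theta := GetWeights piJ piJ' in
  fun p => \sum_J ((1 - theta J) * piJ J p + theta J * piJ' J p).

Definition weights_decrease := forall (pi : X * Y -> R) (P : {set {set I}}),
  measures pi -> composite_partition P ->
  ~ (forall J, current_cells (P := P) pi J = new_cells (P := P) pi J) ->
  (score (update P pi) < score pi)%E.

Fixpoint iterates (JA JB : {set {set I}}) (pi_init : X * Y -> R) (k : nat)
    : plan :=
  if k is k'.+1 then (* k below is k'.+1, so that the first step uses JA *)
    update (if odd k then JA else JB) (iterates JA JB pi_init k')
  else pi_init.

End Problem.

Arguments plan : clear implicits.
Arguments plan_family : clear implicits.
Arguments weights : clear implicits.

(* Main.v *)
Require Import Defs.
From mathcomp Require Import all_boot all_order all_algebra.
From mathcomp Require Import all_classical all_reals all_analysis.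
From mathcomp Require Import ring lra.

Set Implicit Arguments.
Unset Strict Implicit.
Unset Printing Implicit Defensive.
Import Order.TTheory GRing.Theory Num.Theory.
Import numFieldNormedType.Exports.

Local Open Scope classical_set_scope.
Local Open Scope ring_scope.

(** On plans the score is a finite sum: it is a real energy E, namely
    <c, p> plus eps times a Kullback-Leibler sum plus two Csiszar divergences of
    the marginals. The summand [kl] makes E coercive (it is superlinear) and
    strictly convex, and it has slope -oo at 0.

    The cell problem of J is the minimisation of E over the plans that agree
    with the current plan p off the cylinder over the composite cell: the parts
    of the score living off the cylinder only add a constant
    ([cell_score_energy]). One parallel step mixes the minimisers of E over
    disjoint blocks of coordinates.

    Fixed points are optimal ([coordinate_min_global]). If p minimises E over
    each block, then it minimises E along each single coordinate. The infinite
    slope of [kl] at 0 forces all entries of p to be positive; there E is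
    differentiable, so its gradient at p vanishes, and by convexity p is a
    global minimiser. This uses differentiability: a convex function
    with kinks can have coordinatewise minimisers that are not minimisers.

    Convergence is a Lyapunov argument ([cvg_to_minimiser]). The energies of the
    iterates decrease to some limit e, and the iterates stay in a bounded set,
    so they converge along every free ultrafilter on the integers. Let p be such
    a limit of the even iterates. Block minimisers depend continuously on the
    fixed coordinates ([block_min_cvg]) and the weights are continuous, so the
    odd iterates converge to the update of p, and both p and its update have
    energy e. Since a step decreases E strictly away from fixed points, p is the
    minimiser, and e is the minimum of E. Every limit of the
    whole sequence along a free ultrafilter then has minimal energy, hence is
    the unique minimiser, and this is convergence. *)

(** * Convergence along ultrafilters *)

(** If [u @^-1` A] is not in F, its complement can be added to F, and the result
    extends to an ultrafilter along which u stays out of A. *)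
Lemma cvg_ultra (T : Type) (V : topologicalType) (F : set_system T)
    (u : T -> V) (l : V) : Filter F ->
  (forall U, UltraFilter U -> F `<=` U -> u @ U --> l) -> u @ F --> l.
Proof.
move=> FF ul A lA; apply: contrapT => nFA.
pose G := filter_from F (fun B => B `&` ~` (u @^-1` A)).
have GP : ProperFilter G.
  apply: filter_from_proper; last first.
    move=> B FB; apply: contrapT => B0; apply: nFA.
    apply: (@filterS _ F _ B) => [x Bx|//]; apply: contrapT => nA.
    by apply: B0; exists x.
  apply: filter_from_filter; first by exists setT; exact: filterT.
  move=> B C FB FC; exists (B `&` C); first exact: filterI.
  by move=> x [[]].
have [U [UU sGU]] := ultraFilterLemma GP.
have sFU : F `<=` U.
  by move=> B FB; apply: sGU; exists B => // x [].
have UnA : U (~` (u @^-1` A)).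
  by apply: sGU; exists setT; [exact: filterT|move=> x []].
have UA : U (u @^-1` A) by apply: ul lA.
by have [x []] := filter_ex (filterI UA UnA).
Qed.

(** Compactness of [a, b] gives a cluster point, and a function converges along
    an ultrafilter to each of its cluster points. *)
Lemma ultra_bounded_cvg (R : realType) (T : Type) (U : set_system T)
    (u : T -> R) (a b : R) : UltraFilter U -> (forall k, a <= u k <= b) ->
  exists l : R, u @ U --> l.
Proof.
move=> UU uab.
have uI : (u @ U) `[a, b]%classic.
  apply: (@filterS _ U _ setT) => [k _ /=|]; last exact: filterT.
  by rewrite in_itv/= uab.
have [l [_ ul]] := segment_compact (fmap_proper_filter u _) uI.
exists l => A lA; have [//|UnA] := in_ultra_setVsetC (u @^-1` A) UU.
by have [x []] := ul (~` A) A UnA lA.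
Qed.

Lemma cvg_ptws (T : Type) (Z : choiceType) (V : topologicalType)
    (F : set_system T) (u : T -> {ptws Z -> V}) (l : {ptws Z -> V}) :
  Filter F -> (forall z, u k z @[k --> F] --> l z) -> u @ F --> l.
Proof.
move=> FF ul; apply/cvg_sup => z A.
rewrite nbhsE => -[_ [[B oB <-] lB]] /filterS; apply.
by apply: ul; exact: open_nbhs_nbhs.
Qed.

Lemma cvg_ptws_at (T : Type) (Z : choiceType) (V : topologicalType)
    (F : set_system T) (u : T -> {ptws Z -> V}) (l : {ptws Z -> V}) (z : Z) :
  Filter F -> u @ F --> l -> u k z @[k --> F] --> l z.
Proof.
move=> FF ul; apply: (cvg_comp u (fun f : {ptws Z -> V} => f z) ul).
exact: (@proj_continuous Z (fun=> V) z l).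
Qed.

Lemma cvg_sumr (R : realType) (T : Type) (Z : finType) (F : set_system T)
    (u : Z -> T -> R) (l : Z -> R) : Filter F ->
  (forall z, u z @ F --> l z) -> (\sum_z u z k) @[k --> F] --> \sum_z l z.
Proof.
move=> FF ul.
by apply: cvg_big => [|z _]; [exact: add_continuous|exact: ul].
Qed.

(** * Convex functions on the half line *)

Section HalfLine.
Context {R : realType}.
Implicit Types (f : R -> R) (phi : R -> \bar R).

Definition convex_nneg f := forall x y t, 0 <= x -> 0 <= y -> 0 <= t <= 1 ->
  f (t * x + (1 - t) * y) <= t * f x + (1 - t) * f y.

Definition continuous_nneg f := forall x : R, 0 <= x ->
  f y @[y --> within [set y : R | 0 <= y] (nbhs x)] --> f x.

Lemma continuous_nneg_cvg (T : Type) (F : set_system T) f (u : T -> R) (l : R) :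
  Filter F -> continuous_nneg f -> 0 <= l -> (forall k, 0 <= u k) ->
  u @ F --> l -> f (u k) @[k --> F] --> f l.
Proof.
move=> FF fc l0 u0 ul.
apply: (cvg_comp u f _ (fc l l0)) => A /ul.
by apply: (@filterS _ F) => k; apply; exact: u0.
Qed.

Lemma continuous_nneg_pos f (x : R) : {for x, continuous f} ->
  f y @[y --> within [set y : R | 0 <= y] (nbhs x)] --> f x.
Proof.
by move=> fx; apply: cvg_trans fx; apply: cvg_app; exact: cvg_within.
Qed.

(** The chord bounds f from above near 0, so lower semicontinuity suffices for
    continuity at the end point. *)
Lemma chord_continuous0 f :
  (forall t, 0 <= t <= 1 -> f t <= t * f 1 + (1 - t) * f 0) ->
  (forall a, a < f 0 -> \forall y \near (0 : R), 0 <= y -> a < f y) ->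
  f y @[y --> within [set y : R | 0 <= y] (nbhs 0)] --> f 0.
Proof.
move=> fch flsc; apply/cvgrPdist_lt => e e0.
suff : \forall y \near (0 : R), 0 <= y -> `|f 0 - f y| < e by [].
have lb : \forall y \near (0 : R), 0 <= y -> f 0 - e < f y.
  by apply: flsc; rewrite ltrBlDr ltrDl.
have ub : \forall y \near (0 : R), y * f 1 + (1 - y) * f 0 < f 0 + e.
  have : (y * f 1 + (1 - y) * f 0) @[y --> (0 : R)] --> 0 * f 1 + (1 - 0) * f 0.
    apply: cvgD; first by apply: cvgM; [exact: cvg_id|exact: cvg_cst].
    apply: cvgM; last exact: cvg_cst.
    by apply: cvgB; [exact: cvg_cst|exact: cvg_id].
  by move=> /cvgr_lt; apply; rewrite mul0r add0r subr0 mul1r ltrDl.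
have le1 : \forall y \near (0 : R), y <= 1.
  by apply: filterS (lt_nbhsl (@ltr01 R)) => y /ltW.
near=> y => y0.
have /fch h : 0 <= y <= 1 by rewrite y0; near: y.
rewrite distrC ltr_distl; apply/andP; split; first by move: y0; near: y.
by apply: (le_lt_trans h); near: y.
Unshelve. all: by end_near.
Qed.

(** The difference quotients of f at u in the direction v - u are at most
    f v - f u by convexity, and they converge to the derivative. *)
Lemma convex_tangent f (u v : R) : convex_nneg f -> 0 < u -> 0 <= v ->
  derivable f u 1 -> f u + derive1 f u * (v - u) <= f v.
Proof.
move=> fconv u0 v0 fu.
have df : differentiable f u by exact/derivable1_diffP.
have dw : derivable f u (v - u) by exact: diff_derivable.
have Dw : 'D_(v - u) f u = derive1 f u * (v - u).
  rewrite derive1E !deriveE//.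
  by rewrite -[in LHS](mulr1 (v - u)) linearZ /= mulrC.
rewrite -lerBrDl -Dw.
have cw : h^-1 *: (f (h *: (v - u) + u) - f u) @[h --> 0^'+] --> 'D_(v - u) f u.
  apply: cvg_trans dw; apply: cvg_app.
  by apply: within_subset => x /= /gt_eqF ->.
apply: (cvgr_to_le cw); near=> h.
have h0 : 0 < h by near: h; exact: nbhs_right_gt.
have h1 : h <= 1 by near: h; exact: nbhs_right_le.
rewrite /= -[X in X <= _]/(h^-1 * _) mulrC ler_pdivrMr//.
have -> : h *: (v - u) + u = h * v + (1 - h) * u.
  by rewrite -[h *: _]/(h * _); ring.
have := fconv v u h v0 (ltW u0); rewrite (ltW h0) h1 => /(_ isT).
by lra.
Unshelve. all: by end_near.
Qed.

Definition kl (s : R) : R := s * ln s - s + 1.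

(** The tangent of kl at e^a, whose slope is a; up to a factor s it is the
    inequality 1 + x < e^x at x = a - ln s. Letting a vary, these lines give the
    superlinear growth, the strict convexity and the continuity of kl. *)
Lemma kl_gt_tangent a s : 0 <= s -> s != expR a -> a * s - expR a + 1 < kl s.
Proof.
rewrite le_eqVlt => /orP[/eqP <- _|s0].
  by rewrite /kl mulr0 mul0r; have := expR_gt0 a; lra.
move=> sa.
have : a - ln s != 0.
  by apply: contraNneq sa => /subr0_eq ->; rewrite lnK.
move=> /expR_gt1Dx; rewrite expRD expRN lnK ?posrE// ltr_pdivlMr// /kl.
by lra.
Qed.

Lemma kl_ge_tangent a s : 0 <= s -> a * s - expR a + 1 <= kl s.
Proof.
move=> s0; have [->|/(kl_gt_tangent s0)/ltW//] := eqVneq s (expR a).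
by rewrite /kl expRK mulrC.
Qed.

Lemma kl_lt_midpoint x y : 0 <= x -> 0 <= y -> x != y ->
  kl ((x + y) / 2) < (kl x + kl y) / 2.
Proof.
move=> x0 y0 xy; set m := (x + y) / 2.
have m0 : 0 < m.
  rewrite divr_gt0// lt_neqAle addr_ge0// andbT eq_sym paddr_eq0//.
  by apply: contra xy => /andP[/eqP -> /eqP ->].
have mE : expR (ln m) = m by rewrite lnK.
have xm : x != expR (ln m).
  rewrite mE; apply: contra xy => /eqP xm; apply/eqP.
  by move: xm; rewrite /m; lra.
have := kl_gt_tangent x0 xm; have := kl_ge_tangent (ln m) y0.
rewrite mE.
have : ln m * m = ln m * x / 2 + ln m * y / 2 by rewrite /m; ring.
have -> : kl m = ln m * m - m + 1 by rewrite /kl mulrC.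
have : m = x / 2 + y / 2 by rewrite /m; ring.
lra.
Qed.

Lemma kl_continuous : continuous_nneg kl.
Proof.
move=> x; rewrite le_eqVlt => /orP[/eqP <-|x0].
  apply: chord_continuous0 => [t /andP[t0 t1]|a].
    have : t * ln t <= 0 by rewrite mulr_ge0_le0// ln_le0.
    by rewrite /kl ln1 mul0r; lra.
  rewrite {1}/kl mul0r sub0r oppr0 add0r => a1.
  (* The line of slope b takes at 0 the value (1 + a) / 2 > a. *)
  pose b := ln ((1 - a) / 2).
  have bE : expR b = (1 - a) / 2 by rewrite lnK// posrE divr_gt0// subr_gt0.
  have : (b * y - (1 - a) / 2 + 1) @[y --> (0 : R)] --> b * 0 - (1 - a) / 2 + 1.
    apply: cvgD; last exact: cvg_cst.
    apply: cvgB; last exact: cvg_cst.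
    by apply: cvgM; [exact: cvg_cst|exact: cvg_id].
  move=> /cvgr_gt /(_ a); rewrite mulr0.
  have -> : a < 0 - (1 - a) / 2 + 1 by lra.
  move=> /(_ isT); apply: filterS => y ay y0.
  by have := kl_ge_tangent b y0; rewrite bE; exact: lt_le_trans.
apply: continuous_nneg_pos.
apply: cvgD; last exact: cvg_cst.
apply: cvgB; last exact: cvg_id.
by apply: cvgM; [exact: cvg_id|exact: continuous_ln].
Qed.

Lemma kl_derive (x : R) : 0 < x -> is_derive x 1 kl (ln x).
Proof.
move=> x0; have dl := is_derive1_ln x0.
rewrite /kl; apply: is_derive_eq.
by rewrite /GRing.scale /= mulfV ?gt_eqF//; ring.
Qed.

(** What the argument uses of an entropy function that is finite on the half
    line. At 0 the derivative may be infinite, so only continuity is kept. *)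
Definition penalty_function f :=
  [/\ forall x, 0 <= f x, convex_nneg f, continuous_nneg f &
      forall x : R, 0 < x -> derivable f x 1].

Lemma entropy_penalty_function phi : entropy_function phi ->
  (forall x, 0 <= phi x)%E -> (forall x : R, 0 <= x -> (phi x < +oo)%E) ->
  C1_on_interior phi -> penalty_function (fine \o phi).
Proof.
move=> [_ lsc cvx _ _] phi0 phioo C1.
have phiE x : 0 <= x -> phi x = (fine (phi x))%:E.
  by move=> x0; rewrite fineK// ge0_fin_numE// phioo.
have fconv : convex_nneg (fine \o phi).
  move=> x y t x0 y0 t01; have := cvx x y t t01.
  have /andP[t0 t1] := t01.
  rewrite (phiE x)// (phiE y)// (phiE (t * x + (1 - t) * y)); last first.
    by rewrite addr_ge0// mulr_ge0// subr_ge0.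
  by rewrite -!EFinM -EFinD lee_fin.
have fder (x : R) : 0 < x -> derivable (fine \o phi) x 1.
  move=> x0; apply: (C1 x _).1.
  apply: (@filterS _ _ _ [set y | 0 < y]); last exact: lt_nbhsr.
  by move=> y /ltW /phioo.
split=> // x; first exact/fine_ge0/phi0.
rewrite le_eqVlt => /orP[/eqP <-|x0].
  apply: chord_continuous0 => [t t01|a /=].
    by have := fconv 1 0 t ler01 (lexx _) t01; rewrite mulr1 mulr0 addr0.
  rewrite -lte_fin -phiE// => /lsc[V V0 aV].
  apply: filterS V0 => y /aV + y0.
  by rewrite (phiE y)// lte_fin.
apply: continuous_nneg_pos.
exact/differentiable_continuous/derivable1_diffP/fder.
Qed.

End HalfLine.

(** * Block minimisation of a strictly convex coercive energy *)

Section BlockMinimisation.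
Context {R : realType} {Z : finType} (E : (Z -> R) -> R).
Implicit Types (p q : Z -> R) (S : {pred Z}) (U : set_system nat).

Context (E_cvg : forall U (u : nat -> Z -> R) p, ProperFilter U ->
  (forall k, measures (u k)) -> (forall z, u k z @[k --> U] --> p z) ->
  E (u k) @[k --> U] --> E p).
Context (E_coercive : exists C, forall p, measures p -> \sum_z p z <= E p + C).
Context (E_midpoint : forall p q, measures p -> measures q -> p <> q ->
  E (fun z => (p z + q z) / 2) < (E p + E q) / 2).

(** The plans obtained from p by changing the coordinates in S only; with
    [S = predT] these are all the measures. *)
Definition block S p : set (Z -> R) :=
  [set q | measures q /\ forall z, z \notin S -> q z = p z].

Definition block_min S p q :=
  block S p q /\ forall q', block S p q' -> E q <= E q'.

Lemma ultra_sublevel_cvg U (u : nat -> Z -> R) M : UltraFilter U ->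
  (forall k, measures (u k)) -> (forall k, E (u k) <= M) ->
  exists p, measures p /\ forall z, u k z @[k --> U] --> p z.
Proof.
move=> UU um uM; have [C EC] := E_coercive.
have ex z : exists l : R, u k z @[k --> U] --> l.
  apply: (@ultra_bounded_cvg _ _ _ _ 0 (M + C)) => k.
  rewrite um /=; apply: le_trans (_ : \sum_z u k z <= _).
    by rewrite (bigD1 z)//= lerDl sumr_ge0// => i _; exact: um.
  by apply: (le_trans (EC _ (um k))); rewrite lerD2r.
have [p up] := choice ex; exists p; split=> // z.
by apply: (cvgr_to_ge (up z)); apply: nearW => k; exact: um.
Qed.

Lemma cvg_block S U (u v : nat -> Z -> R) p q : ProperFilter U ->
  (forall k, block S (u k) (v k)) -> (forall z, u k z @[k --> U] --> p z) ->
  measures q -> (forall z, v k z @[k --> U] --> q z) -> block S p q.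
Proof.
move=> PU uv up qm vq; split=> // z zS.
apply: (cvg_unique (@Rhausdorff R) (vq z)).
have -> : v ^~ z = u ^~ z by apply/funext => k; exact: (uv k).2.
exact: up.
Qed.

(** A minimising sequence is bounded by coercivity; take its limit along an
    ultrafilter. *)
Lemma block_min_exists S p : measures p -> exists q, block_min S p q.
Proof.
move=> pm; have [C EC] := E_coercive.
pose V := [set E q | q in block S p].
have Vinf : has_inf V.
  split; first by exists (E p), p => //; split.
  (* Coercivity also bounds E from below, since masses are nonnegative. *)
  exists (- C) => _ [q [qm _] <-].
  by rewrite -subr_ge0 opprK; apply: le_trans (EC _ qm); exact: sumr_ge0.
have ex k : exists q, block S p q /\ E q < inf V + k.+1%:R^-1.
  have k0 : 0 < k.+1%:R^-1 :> R by rewrite invr_gt0.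
  by have [_ [q qb <-] qlt] := inf_adherent k0 Vinf; exists q.
have [v vP] := choice ex.
have [U [UU sU]] := ultraFilterLemma (eventually_filter).
have vm k : measures (v k) by have [[]] := vP k.
have [k|q [qm vq]] := ultra_sublevel_cvg (M := inf V + 1) UU vm.
  have [_ /ltW /le_trans] := vP k; apply.
  by rewrite lerD2l invf_le1// ler1n.
have qb : block S p q.
  apply: (cvg_block _ (fun k => (vP k).1) _ qm vq) => z.
  exact: cvg_cst.
exists q; split=> // q' q'b; apply: (@le_trans _ _ (inf V)); last first.
  by apply: (ge_inf Vinf.2); exists q'.
have hU : (k.+1%:R^-1 : R) @[k --> U] --> (0 : R).
  by move=> A /(@cvg_harmonic R)/sU.
have /cvgr_to_le : E (v k) - k.+1%:R^-1 @[k --> U] --> E q - 0.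
  by apply: cvgB => //; exact: E_cvg vm vq.
rewrite subr0; apply; apply: nearW => k.
by rewrite lerBlDr ltW//; have [] := vP k.
Qed.

Lemma block_min_unique S p q q' :
  block_min S p q -> block_min S p q' -> q = q'.
Proof.
move=> [[qm qS] qmin] [[q'm q'S] q'min].
apply: contrapT => /(E_midpoint qm q'm).
have mb : block S p (fun z => (q z + q' z) / 2).
  split=> [z|z zS]; first by rewrite divr_ge0// addr_ge0.
  by rewrite qS// q'S//; lra.
have := qmin _ mb; have := q'min _ mb; lra.
Qed.

(** Continuity of the block minimiser in the fixed coordinates: the limit q of
    the minimisers satisfies E q <= E q' for all q' in the block of p, because
    q' is the limit of its transplants to the blocks of the u k. *)
Lemma block_min_cvg S U (u v : nat -> Z -> R) p M : UltraFilter U ->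
  (forall k, measures (u k)) -> (forall k, E (u k) <= M) ->
  (forall k, block_min S (u k) (v k)) ->
  measures p -> (forall z, u k z @[k --> U] --> p z) ->
  exists q, block_min S p q /\ forall z, v k z @[k --> U] --> q z.
Proof.
move=> UU um uM uv pm up.
have vm k : measures (v k) by have [[]] := uv k.
have vM k : E (v k) <= M.
  by apply: le_trans (uM k); apply: (uv k).2; split=> //; exact: um.
have [q [qm vq]] := ultra_sublevel_cvg UU vm vM.
exists q; split=> //; split.
  exact: (cvg_block _ (fun k => (uv k).1) up qm vq).
move=> q' [q'm q'S].
(* The transplant of q' to the block of u k. *)
pose w k z := if z \in S then q' z else u k z.
have wm k : measures (w k).
  by move=> z; rewrite /w; case: ifP => _; [exact: q'm|exact: um].
have wq' z : w k z @[k --> U] --> q' z.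
  have [zS|zS] := boolP (z \in S); first by rewrite /w zS; exact: cvg_cst.
  by rewrite /w (negbTE zS) q'S//; exact: up.
apply: (ler_cvg_to (E_cvg _ vm vq) (E_cvg _ wm wq')).
apply: nearW => k; apply: (uv k).2; split=> // z zS.
by rewrite /w (negbTE zS).
Qed.

(** The convergence argument for a descent method, of which only the steps from
    even to odd indices need be understood: p' is the image under such a step of
    a limit p of even iterates, and a step without decrease of the energy must
    start at the minimiser. *)
Lemma cvg_to_minimiser (s : nat -> Z -> R) pmin :
  (forall k, measures (s k)) -> (forall k, E (s k.+1) <= E (s k)) ->
  block_min predT (s 0) pmin ->
  (forall U p, UltraFilter U -> \oo `<=` U -> measures p ->
    (forall z, s k.*2 z @[k --> U] --> p z) ->
    exists2 p', (forall z, s k.*2.+1 z @[k --> U] --> p' z) &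
      E p' = E p -> p = pmin) ->
  forall z, s k z @[k --> \oo] --> pmin z.
Proof.
move=> sm sdecr pminP step.
have sle : nonincreasing_seq (fun k => E (s k)).
  by apply/nonincreasing_seqP.
have slb : has_lbound (range (fun k => E (s k))).
  by exists (E pmin) => _ [k _ <-]; apply: pminP.2; split.
have Es := nonincreasing_cvgn sle slb; set e := inf _ in Es.
have sM k : E (s k) <= E (s 0) by exact: sle.
have Ecvg U p (g : nat -> nat) : UltraFilter U -> \oo `<=` U ->
    (forall k, (k <= g k)%N) -> (forall z, s (g k) z @[k --> U] --> p z) ->
    E p = e.
  move=> UU sU gk sp.
  have := E_cvg _ (fun k => sm (g k)) sp => /(_ _).
  move=> /(cvg_unique (@Rhausdorff R)); apply.
  move=> A /Es [N _ NA]; apply: sU; exists N => // k /= Nk.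
  by apply: NA; exact: leq_trans (gk k).
have dbl k : (k <= k.*2)%N by rewrite -addnn leq_addr.
have eE : e = E pmin.
  have [U [UU sU]] := ultraFilterLemma (eventually_filter).
  have [p [pm sp]] :=
    ultra_sublevel_cvg UU (fun k => sm k.*2) (fun k => sM k.*2).
  have [p' sp' p'E] := step U p UU sU pm sp.
  rewrite -p'E; first by rewrite (Ecvg U p double).
  rewrite (Ecvg U p double)// (Ecvg U p' (fun k => k.*2.+1))// => k.
  exact: leqW.
move=> z; apply: cvg_ultra => U UU sU.
have [p [pm sp]] := ultra_sublevel_cvg UU sm sM.
suff -> : pmin = p by exact: sp.
apply: (block_min_unique pminP); split; first by split.
by move=> q qb; rewrite (Ecvg U p id)// eE; exact: pminP.2.
Qed.

End BlockMinimisation.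

(** * The entropic unbalanced transport energy *)

Section Energy.
Context {R : realType} {X Y : finType}.
Context (mu : X -> R) (nu : Y -> R) (c : X * Y -> R) (eps : R) (f1 f2 : R -> R).
Context (mu_gt0 : full_support mu) (nu_gt0 : full_support nu).
Context (eps_gt0 : 0 < eps).
Context (f1P : penalty_function f1) (f2P : penalty_function f2).
Implicit Types (p q : X * Y -> R).

Let m := prod_meas mu nu.

Let f1_ge0 : forall x, 0 <= f1 x. Proof. by case: f1P. Qed.
Let f2_ge0 : forall x, 0 <= f2 x. Proof. by case: f2P. Qed.
Let f1_convex : convex_nneg f1. Proof. by case: f1P. Qed.
Let f2_convex : convex_nneg f2. Proof. by case: f2P. Qed.
Let f1_cont : continuous_nneg f1. Proof. by case: f1P. Qed.
Let f2_cont : continuous_nneg f2. Proof. by case: f2P. Qed.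
Let f1_der : forall x : R, 0 < x -> derivable f1 x 1. Proof. by case: f1P. Qed.
Let f2_der : forall x : R, 0 < x -> derivable f2 x 1. Proof. by case: f2P. Qed.

(** The Csiszar divergence of rho from sigma as a real number, for rho
    absolutely continuous with respect to sigma. *)
Definition fdiv (Z : finType) (f : R -> R) (rho sigma : Z -> R) : R :=
  \sum_z f (density rho sigma z) * sigma z.

Definition energy p : R :=
  pairing c p + eps * fdiv kl p m
  + fdiv f1 (margX p) mu + fdiv f2 (margY p) nu.

Lemma prod_meas_gt0 z : 0 < m z.
Proof. by rewrite mulr_gt0. Qed.

Lemma margX_ge0 p x : measures p -> 0 <= margX p x.
Proof. by move=> pm; exact: sumr_ge0. Qed.

Lemma margY_ge0 p y : measures p -> 0 <= margY p y.
Proof. by move=> pm; exact: sumr_ge0. Qed.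

Lemma le_margX p x y : measures p -> p (x, y) <= margX p x.
Proof. by move=> pm; rewrite /margX (bigD1 y)//= lerDl sumr_ge0. Qed.

Lemma le_margY p x y : measures p -> p (x, y) <= margY p y.
Proof. by move=> pm; rewrite /margY (bigD1 x)//= lerDl sumr_ge0. Qed.

Lemma fdiv_cvg (Z : finType) f (sigma : Z -> R) (U : set_system nat)
    (u : nat -> Z -> R) (p : Z -> R) : ProperFilter U ->
  continuous_nneg f -> full_support sigma -> (forall k, measures (u k)) ->
  (forall z, u k z @[k --> U] --> p z) ->
  fdiv f (u k) sigma @[k --> U] --> fdiv f p sigma.
Proof.
move=> PU fc s0 um up; apply: cvg_sumr => z; apply: cvgM; last exact: cvg_cst.
have d0 k : 0 <= density (u k) sigma z by rewrite divr_ge0 ?um// ltW.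
have dc : density (u k) sigma z @[k --> U] --> density p sigma z.
  by apply: cvgM; [exact: up|exact: cvg_cst].
apply: continuous_nneg_cvg => //.
by apply: (cvgr_to_ge dc); exact: nearW.
Qed.

Lemma energy_cvg (U : set_system nat) (u : nat -> X * Y -> R) p :
  ProperFilter U -> (forall k, measures (u k)) ->
  (forall z, u k z @[k --> U] --> p z) -> energy (u k) @[k --> U] --> energy p.
Proof.
move=> PU um up; rewrite /energy.
apply: cvgD; [apply: cvgD; [apply: cvgD|]|].
- by apply: cvg_sumr => z; apply: cvgM; [exact: cvg_cst|exact: up].
- apply: cvgM; first exact: cvg_cst.
  by apply: fdiv_cvg => //; [exact: kl_continuous|exact: prod_meas_gt0].
- apply: fdiv_cvg => // [k x|x]; first exact: margX_ge0.
  by apply: cvg_sumr => y; exact: up.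
- apply: fdiv_cvg => // [k y|y]; first exact: margY_ge0.
  by apply: cvg_sumr => x; exact: up.
Qed.

Lemma fdiv_ge0 (Z : finType) (f : R -> R) (rho sigma : Z -> R) :
  (forall x, 0 <= f x) -> full_support sigma -> 0 <= fdiv f rho sigma.
Proof.
by move=> f0 s0; apply: sumr_ge0 => z _; rewrite mulr_ge0// ltW.
Qed.

(** With the tangent to kl of slope (1 - c z) / eps, transport cost and entropy
    at z together grow at least like the mass at z. *)
Lemma energy_coercive :
  exists C, forall p, measures p -> \sum_z p z <= energy p + C.
Proof.
pose a z := (1 - c z) / eps.
exists (\sum_z eps * (expR (a z) - 1) * m z) => p pm.
have h1 := fdiv_ge0 (margX p) f1_ge0 mu_gt0.
have h2 := fdiv_ge0 (margY p) f2_ge0 nu_gt0.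
suff : \sum_z p z <= pairing c p + eps * fdiv kl p m +
    \sum_z eps * (expR (a z) - 1) * m z by rewrite /energy; lra.
rewrite /pairing /fdiv mulr_sumr -!big_split /=; apply: ler_sum => z _.
have m0 := prod_meas_gt0 z.
have d0 : 0 <= density p m z by rewrite divr_ge0// ltW.
have /(ler_wpM2r (ltW m0))/(ler_wpM2l (ltW eps_gt0)) := kl_ge_tangent (a z) d0.
have -> : eps * ((a z * density p m z - expR (a z) + 1) * m z) =
    (1 - c z) * p z - eps * (expR (a z) - 1) * m z.
  by rewrite /a /density; field; rewrite !gt_eqF.
lra.
Qed.

Lemma fdiv_midpoint (Z : finType) f (sigma rho rho' : Z -> R) :
  convex_nneg f -> full_support sigma -> measures rho -> measures rho' ->
  fdiv f (fun z => (rho z + rho' z) / 2) sigma <=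
  (fdiv f rho sigma + fdiv f rho' sigma) / 2.
Proof.
move=> fc s0 r0 r'0; rewrite /fdiv -big_split /= mulr_suml.
apply: ler_sum => z _; have sz := s0 z.
have d0 (r : Z -> R) : measures r -> 0 <= density r sigma z.
  by move=> ?; rewrite divr_ge0// ltW.
have h : 0 <= (1 / 2 : R) <= 1 by apply/andP; split; lra.
have /(ler_wpM2r (ltW sz)) := fc _ _ _ (d0 _ r0) (d0 _ r'0) h.
rewrite [X in f X](_ : _ = density (fun z => (rho z + rho' z) / 2) sigma z).
  move=> /le_trans; apply; rewrite le_eqVlt; apply/orP; left.
  by apply/eqP; field.
by rewrite /density; field; rewrite gt_eqF.
Qed.

Lemma margX_midpoint p q :
  margX (fun z => (p z + q z) / 2) = fun x => (margX p x + margX q x) / 2.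
Proof. by apply/funext => x; rewrite /margX -big_split/= mulr_suml. Qed.

Lemma margY_midpoint p q :
  margY (fun z => (p z + q z) / 2) = fun y => (margY p y + margY q y) / 2.
Proof. by apply/funext => y; rewrite /margY -big_split/= mulr_suml. Qed.

Lemma energy_midpoint p q : measures p -> measures q -> p <> q ->
  energy (fun z => (p z + q z) / 2) < (energy p + energy q) / 2.
Proof.
move=> pm qm pq.
have h1 := fdiv_midpoint f1_convex mu_gt0 (fun x => margX_ge0 x pm)
  (fun x => margX_ge0 x qm).
have h2 := fdiv_midpoint f2_convex nu_gt0 (fun y => margY_ge0 y pm)
  (fun y => margY_ge0 y qm).
have hc :
    pairing c (fun z => (p z + q z) / 2) = (pairing c p + pairing c q) / 2.
  by rewrite /pairing -big_split/= mulr_suml; apply: eq_bigr => z _; ring.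
rewrite /energy margX_midpoint margY_midpoint hc.
suff : fdiv kl (fun z => (p z + q z) / 2) m <
    (fdiv kl p m + fdiv kl q m) / 2.
  move=> h; have := h; rewrite -subr_gt0 => /(mulr_gt0 eps_gt0); lra.
have [z0 pqz0] : exists z, p z != q z.
  apply: contrapT => h; apply: pq; apply/funext => z; apply/eqP.
  by apply: contrapT => /negP pqz; apply: h; exists z.
have lt z : p z != q z -> kl (density (fun z => (p z + q z) / 2) m z) * m z <
    (kl (density p m z) * m z + kl (density q m z) * m z) / 2.
  move=> pqz; rewrite -mulrDl mulrAC ltr_pM2r ?prod_meas_gt0//.
  rewrite [X in kl X](_ : _ = (density p m z + density q m z) / 2); last first.
    by rewrite /density; field; rewrite gt_eqF ?prod_meas_gt0.
  have m0 := prod_meas_gt0 z.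
  apply: kl_lt_midpoint; rewrite ?divr_ge0 ?(ltW m0)//.
  by apply: contra pqz => /eqP/(mulIf (invr_neq0 (lt0r_neq0 m0))) ->.
rewrite /fdiv -big_split /= mulr_suml (bigD1 z0)//= [ltRHS](bigD1 z0)//=.
apply: ltr_leD; first exact: lt.
apply: ler_sum => z _.
have [pqz|/lt/ltW//] := eqVneq (p z) (q z).
by rewrite /density pqz le_eqVlt; apply/orP; left; apply/eqP;
  rewrite (_ : (q z + q z) / 2 = q z); lra.
Qed.

(** ** First-order optimality *)

Definition bump (Z : eqType) (rho : Z -> R) (z0 : Z) (t : R) : Z -> R :=
  fun z => rho z + (z == z0)%:R * t.

Lemma sum_bump (Z : finType) (G : Z -> R -> R) (rho : Z -> R) z0 t :
  \sum_z G z (bump rho z0 t z) =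
  \sum_z G z (rho z) + (G z0 (rho z0 + t) - G z0 (rho z0)).
Proof.
rewrite (bigD1 z0)//= [in RHS](bigD1 z0)//= /bump eqxx mul1r.
under eq_bigr => z /negbTE zz0 do rewrite zz0 mul0r addr0.
by ring.
Qed.

Lemma margX_bump p z t : margX (bump p z t) = bump (margX p) z.1 t.
Proof.
case: z => x0 y0; apply/funext => x; rewrite /margX /bump big_split/=.
congr (_ + _); rewrite (bigD1 y0)//= big1 => [|y /negbTE yy0].
  by rewrite xpair_eqE eqxx andbT addr0.
by rewrite xpair_eqE yy0 andbF mul0r.
Qed.

Lemma margY_bump p z t : margY (bump p z t) = bump (margY p) z.2 t.
Proof.
case: z => x0 y0; apply/funext => y; rewrite /margY /bump big_split/=.
congr (_ + _); rewrite (bigD1 x0)//= big1 => [|x /negbTE xx0].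
  by rewrite xpair_eqE eqxx addr0.
by rewrite xpair_eqE xx0 mul0r.
Qed.

(** Up to a constant, the energy along the coordinate z. *)
Definition slice p (z : X * Y) (t : R) : R :=
  c z * (p z + t) + eps * (kl ((p z + t) / m z) * m z)
  + f1 ((margX p z.1 + t) / mu z.1) * mu z.1
  + f2 ((margY p z.2 + t) / nu z.2) * nu z.2.

Lemma energy_bump p z t :
  energy (bump p z t) - energy p = slice p z t - slice p z 0.
Proof.
rewrite /energy margX_bump margY_bump /slice !addr0.
have -> : pairing c (bump p z t) = pairing c p + (c z * (p z + t) - c z * p z).
  exact: (sum_bump (fun z r => c z * r)).
have pen (Z : finType) f (rho sigma : Z -> R) z0 :
    fdiv f (bump rho z0 t) sigma = fdiv f rho sigma +
      (f ((rho z0 + t) / sigma z0) * sigma z0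
       - f (rho z0 / sigma z0) * sigma z0).
  exact: (sum_bump (fun z r => f (r / sigma z) * sigma z)).
by rewrite !pen; ring.
Qed.

Lemma slice_min p z t : block_min energy (pred1 z) p p -> 0 <= p z + t ->
  slice p z 0 <= slice p z t.
Proof.
move=> [[pm _] pmin] pt; rewrite -subr_ge0 -energy_bump subr_ge0; apply: pmin.
split=> z' /=; last by rewrite inE /bump => /negbTE ->; rewrite mul0r addr0.
by rewrite /bump; case: eqVneq => [->|_]; rewrite ?mul1r ?mul0r ?addr0.
Qed.

(** Convexity bounds the slope at a linearly in t, even when f has slope -oo at
    0. *)
Lemma convex_increment f (a s t : R) : convex_nneg f -> 0 <= a -> 0 < s ->
  0 <= t <= 1 ->
  f ((a + t) / s) * s - f (a / s) * s <=
  t * (f ((a + 1) / s) * s - f (a / s) * s).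
Proof.
move=> fc a0 s0 t01.
have d1 : 0 <= (a + 1) / s by apply: divr_ge0; [exact: addr_ge0|exact: ltW].
have d0 : 0 <= a / s by rewrite divr_ge0// ltW.
have /(ler_wpM2r (ltW s0)) := fc _ _ _ d1 d0 t01.
rewrite [X in f X](_ : _ = (a + t) / s); first by lra.
by field; rewrite gt_eqF.
Qed.

(** Adding a mass t at a zero of p costs at most linear terms in t, against
    a gain of order t ln t from kl. *)
Lemma coordinate_min_gt0 p z : block_min energy (pred1 z) p p -> 0 < p z.
Proof.
move=> pmin; have pm := pmin.1.1.
rewrite lt_neqAle pm andbT; apply/eqP => pz0.
pose D1 := f1 ((margX p z.1 + 1) / mu z.1) * mu z.1
  - f1 (margX p z.1 / mu z.1) * mu z.1.
pose D2 := f2 ((margY p z.2 + 1) / nu z.2) * nu z.2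
  - f2 (margY p z.2 / nu z.2) * nu z.2.
(* D1 and D2 bound the slopes of the two divergences; K is chosen such that
   ln (t / m z) <= - K makes the total slope at most - eps. *)
pose K := (c z + D1 + D2) / eps.
have m0 := prod_meas_gt0 z.
pose t := Num.min 1 (m z * expR (- K)).
have t0 : 0 < t by rewrite lt_min ltr01 mulr_gt0// expR_gt0.
have t1 : 0 <= t <= 1 by rewrite (ltW t0) ge_min lexx.
have lnt : ln (t / m z) <= - K.
  rewrite -[leRHS]expRK ler_ln ?posrE ?expR_gt0 ?divr_gt0//.
  by rewrite ler_pdivrMr// mulrC ge_min lexx orbT.
have h1 := convex_increment f1_convex (margX_ge0 z.1 pm) (mu_gt0 z.1) t1.
have h2 := convex_increment f2_convex (margY_ge0 z.2 pm) (nu_gt0 z.2) t1.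
rewrite -/D1 in h1; rewrite -/D2 in h2.
have := slice_min (t := t) pmin.
rewrite -pz0 add0r (ltW t0) => /(_ isT); rewrite /slice -pz0 !(add0r, addr0).
have -> : kl (t / m z) * m z = t * ln (t / m z) - t + m z.
  by rewrite /kl; field; rewrite gt_eqF.
rewrite /kl !mul0r mulr0.
have : t * (eps * ln (t / m z)) <= t * - (c z + D1 + D2).
  rewrite ler_pM2l//; apply: le_trans (_ : eps * - K <= _).
    by rewrite ler_pM2l.
  by rewrite /K mulrN mulrC divfK// gt_eqF.
have := mulr_gt0 t0 eps_gt0.
lra.
Qed.

Definition gradient p (z : X * Y) : R :=
  c z + eps * ln (p z / m z) + derive1 f1 (margX p z.1 / mu z.1)
  + derive1 f2 (margY p z.2 / nu z.2).

Lemma is_derive_scaled (f : R -> R) (a s t d : R) : 0 < s ->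
  is_derive ((a + t) / s) 1 f d ->
  is_derive t 1 (fun t => f ((a + t) / s) * s) d.
Proof.
move=> s0 fd.
have gd : is_derive t 1 (fun t : R => (a + t) / s) s^-1.
  by apply: is_derive_eq; rewrite /GRing.scale/=; ring.
have h := @is_derive1_comp R f (fun t => (a + t) / s) t _ _ fd gd.
rewrite (_ : (fun _ => _) = (fun t => (f \o (fun t => (a + t) / s)) t * s))//.
by apply: is_derive_eq; rewrite /GRing.scale/=; field; rewrite gt_eqF.
Qed.

Lemma is_derive_slice p z t : measures p -> 0 < p z + t ->
  is_derive t 1 (slice p z)
   (c z + eps * ln ((p z + t) / m z) + derive1 f1 ((margX p z.1 + t) / mu z.1)
    + derive1 f2 ((margY p z.2 + t) / nu z.2)).
Proof.
move=> pm pt; have m0 := prod_meas_gt0 z.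
have Xt : 0 < margX p z.1 + t.
  by apply: (lt_le_trans pt); rewrite lerD2r; case: (z) => x y; exact: le_margX.
have Yt : 0 < margY p z.2 + t.
  by apply: (lt_le_trans pt); rewrite lerD2r; case: (z) => x y; exact: le_margY.
have d1 : is_derive ((margX p z.1 + t) / mu z.1) 1 f1
    (derive1 f1 ((margX p z.1 + t) / mu z.1)).
  by rewrite derive1E; apply: derivableP; apply: f1_der; rewrite divr_gt0.
have d2 : is_derive ((margY p z.2 + t) / nu z.2) 1 f2
    (derive1 f2 ((margY p z.2 + t) / nu z.2)).
  by rewrite derive1E; apply: derivableP; apply: f2_der; rewrite divr_gt0.
have {}d1 := is_derive_scaled (mu_gt0 z.1) d1.
have {}d2 := is_derive_scaled (nu_gt0 z.2) d2.
have dk := is_derive_scaled m0 (kl_derive (divr_gt0 pt m0)).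
rewrite /slice; apply: is_derive_eq.
by rewrite /GRing.scale/=; ring.
Qed.

Lemma coordinate_min_gradient p z : block_min energy (pred1 z) p p ->
  gradient p z = 0.
Proof.
move=> pmin; have pm := pmin.1.1; have p0 := coordinate_min_gt0 pmin.
have in0 t : t \in `](- p z), (p z)[ -> 0 < p z + t.
  by rewrite in_itv/= => /andP[h _]; rewrite addrC -ltrBlDr sub0r.
have h0 : 0 \in `](- p z), (p z)[ by rewrite in_itv/= oppr_lt0 p0.
have d0 : is_derive (0 : R) 1 (slice p z) 0.
  apply: (@derive1_at_min R (slice p z) (- p z) (p z) 0 _ _ h0).
  - by rewrite ge0_cp// ltW.
  - move=> t /in0 pt.
    exact: (@ex_derive _ _ _ _ _ _ _ (is_derive_slice pm pt)).
  - by move=> t /in0/ltW; exact: slice_min.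
have pz0 : 0 < p z + 0 by rewrite addr0.
have d := is_derive_slice pm pz0.
have := @derive_val _ _ _ _ _ _ _ d0.
by rewrite (@derive_val _ _ _ _ _ _ _ d) !addr0.
Qed.

(** The tangent inequality for f, integrated against sigma. The slopes [f'] are
    kept abstract because those of kl are known in closed form. *)
Lemma fdiv_tangent (Z : finType) f f' (sigma rho rho' : Z -> R) :
  full_support sigma ->
  (forall z, f (rho z / sigma z) + f' z * (rho' z / sigma z - rho z / sigma z)
    <= f (rho' z / sigma z)) ->
  fdiv f rho sigma + \sum_z f' z * (rho' z - rho z) <= fdiv f rho' sigma.
Proof.
move=> s0 tan; rewrite /fdiv -big_split/=; apply: ler_sum => z _.
have /(ler_wpM2r (ltW (s0 z)))/(le_trans _) := tan z; apply.
rewrite le_eqVlt; apply/orP; left; apply/eqP.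
by rewrite /density; field; rewrite gt_eqF.
Qed.

Lemma sum_margX p q (g : X -> R) :
  \sum_z g z.1 * (q z - p z) = \sum_x g x * (margX q x - margX p x).
Proof.
under [RHS]eq_bigr do rewrite -sumrB mulr_sumr.
by rewrite pair_bigA; apply: eq_bigr => -[x y].
Qed.

Lemma sum_margY p q (g : Y -> R) :
  \sum_z g z.2 * (q z - p z) = \sum_y g y * (margY q y - margY p y).
Proof.
under [RHS]eq_bigr do rewrite -sumrB mulr_sumr.
by rewrite exchange_big pair_bigA; apply: eq_bigr => -[x y].
Qed.

(** At p all entries are positive, so the energy lies above its tangent plane at
    p, and that plane is horizontal by [coordinate_min_gradient]. *)
Lemma coordinate_min_global p :
  (forall z, block_min energy (pred1 z) p p) -> measures p ->
  block_min energy predT p p.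
Proof.
move=> pmin pm; split; first by split.
move=> q [qm _].
have p0 z := coordinate_min_gt0 (pmin z).
have tk : fdiv kl p m + \sum_z ln (p z / m z) * (q z - p z) <= fdiv kl q m.
  apply: fdiv_tangent => [|z]; first exact: prod_meas_gt0.
  have m0 := prod_meas_gt0 z; have u0 : 0 < p z / m z by rewrite divr_gt0.
  have v0 : 0 <= q z / m z by rewrite divr_ge0// ltW.
  have := kl_ge_tangent (ln (p z / m z)) v0; rewrite lnK ?posrE//.
  set u := p z / m z in u0 *.
  have -> : kl u = ln u * u - u + 1 by rewrite /kl mulrC.
  lra.
(* If X * Y is empty, the marginals vanish and carry no derivative. *)
have [[x0 y0] _|no_z] := pickP (@predT (X * Y)%type); last first.
  by rewrite (_ : q = p)//; apply/funext => z; have := no_z z.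
have PX x : 0 < margX p x / mu x.
  by rewrite divr_gt0// (lt_le_trans (p0 (x, y0)))// le_margX.
have PY y : 0 < margY p y / nu y.
  by rewrite divr_gt0// (lt_le_trans (p0 (x0, y)))// le_margY.
have tX : fdiv f1 (margX p) mu
    + \sum_z derive1 f1 (margX p z.1 / mu z.1) * (q z - p z)
    <= fdiv f1 (margX q) mu.
  rewrite (sum_margX _ _ (fun x => derive1 f1 (margX p x / mu x))).
  apply: fdiv_tangent => // x.
  apply: convex_tangent => //; last exact/f1_der/PX.
  by rewrite divr_ge0 ?margX_ge0// ltW.
have tY : fdiv f2 (margY p) nu
    + \sum_z derive1 f2 (margY p z.2 / nu z.2) * (q z - p z)
    <= fdiv f2 (margY q) nu.
  rewrite (sum_margY _ _ (fun y => derive1 f2 (margY p y / nu y))).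
  apply: fdiv_tangent => // y.
  apply: convex_tangent => //; last exact/f2_der/PY.
  by rewrite divr_ge0 ?margY_ge0// ltW.
have : \sum_z gradient p z * (q z - p z) = 0.
  by rewrite big1// => z _; rewrite coordinate_min_gradient// mul0r.
have -> : \sum_z gradient p z * (q z - p z) =
    pairing c q - pairing c p + eps * (\sum_z ln (p z / m z) * (q z - p z))
    + \sum_z derive1 f1 (margX p z.1 / mu z.1) * (q z - p z)
    + \sum_z derive1 f2 (margY p z.2 / nu z.2) * (q z - p z).
  rewrite /pairing -sumrB mulr_sumr -!big_split/=; apply: eq_bigr => z _.
  by rewrite /gradient; ring.
move: tk => /(ler_wpM2l (ltW eps_gt0)).
rewrite /energy; lra.
Qed.

End Energy.

(** * The scores as real energies *)

Section Score.
Context {R : realType}.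

(** There is no singular part, so the recession term vanishes even when the
    recession constant is infinite. *)
Lemma divergence_fdiv (Z : finType) (phi : R -> \bar R) (rho sigma : Z -> R) :
  (forall x, 0 <= phi x)%E -> (forall x : R, 0 <= x -> (phi x < +oo)%E) ->
  measures rho -> measures sigma -> abs_continuous rho sigma ->
  divergence phi rho sigma = (fdiv (fine \o phi) rho sigma)%:E.
Proof.
move=> phi0 phioo rho0 sigma0 ac; rewrite /divergence.
rewrite [X in (_ * X%:E)%E]big1 => [|z _]; last first.
  by rewrite /singular; case: ifPn => // /eqP/ac.
rewrite mule0 adde0 /fdiv -sumEFin; apply: eq_bigr => z _.
by rewrite EFinM/= fineK// ge0_fin_numE// phioo// divr_ge0.
Qed.

Lemma KL_fdiv (Z : finType) (rho sigma : Z -> R) :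
  abs_continuous rho sigma -> KL rho sigma = (fdiv kl rho sigma)%:E.
Proof. by move=> ac; rewrite /KL asboolT. Qed.

Lemma restriction_in (Z : finType) (rho : Z -> R) (S : {pred Z}) z :
  z \in S -> restriction rho S z = rho z.
Proof. by rewrite /restriction => ->. Qed.

Lemma restriction_out (Z : finType) (rho : Z -> R) (S : {pred Z}) z :
  z \notin S -> restriction rho S z = 0.
Proof. by rewrite /restriction => /negbTE ->. Qed.

Lemma fdiv_glue (Z : finType) (f : R -> R) (rho tau sigma : Z -> R)
    (S : {pred Z}) :
  (forall z, z \notin S -> rho z = 0) -> (forall z, z \in S -> tau z = 0) ->
  fdiv f (fun z => rho z + tau z) sigma =
  fdiv f rho (restriction sigma S)
  + \sum_(z | z \notin S) f (density tau sigma z) * sigma z.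
Proof.
move=> rho0 tau0; rewrite /fdiv (bigID (mem S))/=; congr (_ + _).
  rewrite [RHS](bigID (mem S))/= [X in _ + X]big1 => [|z /negbTE zS].
    rewrite addr0; apply: eq_bigr => z zS.
    by rewrite /density /restriction zS tau0// addr0.
  by rewrite /restriction zS mulr0.
by apply: eq_bigr => z zS; rewrite /density rho0// add0r.
Qed.

Context {X Y I : finType}.
Context (mu : X -> R) (nu : Y -> R) (c : X * Y -> R) (eps : R).
Context (phi1 phi2 : R -> \bar R) (Xc : I -> {set X}).
Context (mu_gt0 : full_support mu) (nu_gt0 : full_support nu).
Context (eps_gt0 : 0 < eps).
Context (phi1_entropy : entropy_function phi1).
Context (phi2_entropy : entropy_function phi2).
Context (phi1_ge0 : forall x : R, (0 <= phi1 x)%E).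
Context (phi2_ge0 : forall x : R, (0 <= phi2 x)%E).
Context (phi1_fin : forall x : R, 0 <= x -> (phi1 x < +oo)%E).
Context (phi2_fin : forall x : R, 0 <= x -> (phi2 x < +oo)%E).
Context (phi1_C1 : C1_on_interior phi1) (phi2_C1 : C1_on_interior phi2).
Context (Xc_partition : basic_partition mu Xc).
Implicit Types (p q : X * Y -> R) (J : {set I}) (P : {set {set I}}).

Let E := energy mu nu c eps (fine \o phi1) (fine \o phi2).
Let cells J : {pred X * Y} := cylinder (composite_cell Xc J).
Let solution J p := cell_solution mu nu c eps phi1 phi2 Xc J p.

Let f1P := entropy_penalty_function phi1_entropy phi1_ge0 phi1_fin phi1_C1.
Let f2P := entropy_penalty_function phi2_entropy phi2_ge0 phi2_fin phi2_C1.
Let E_cvg := energy_cvg (c := c) (eps := eps) mu_gt0 nu_gt0 f1P f2P.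
Let E_coercive := energy_coercive c mu_gt0 nu_gt0 eps_gt0 f1P f2P.
Let E_midpoint := energy_midpoint c mu_gt0 nu_gt0 eps_gt0 f1P f2P.

Lemma score_energy p : measures p ->
  score mu nu c eps phi1 phi2 p = (E p)%:E.
Proof.
move=> pm; rewrite /score KL_fdiv; last first.
  by move=> z /eqP; rewrite gt_eqF// mulr_gt0.
rewrite !divergence_fdiv//.
- by move=> y; exact: margY_ge0.
- by move=> y; exact: ltW.
- by move=> y /eqP; rewrite gt_eqF.
- by move=> x; exact: margX_ge0.
- by move=> x; exact: ltW.
- by move=> x /eqP; rewrite gt_eqF.
Qed.

(** The whole plan that the cell problem of J sees: q on the cylinder over the
    composite cell, p elsewhere. *)
Definition glue J p q : X * Y -> R :=
  fun z => q z + restriction p (cylinder (~: composite_cell Xc J)%SET) z.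

Lemma restr_off J p z : z \in cells J ->
  restriction p (cylinder (~: composite_cell Xc J)%SET) z = 0.
Proof. by rewrite /restriction !inE => ->. Qed.

Lemma glue_in J p q z : z \in cells J -> glue J p q z = q z.
Proof. by move=> zJ; rewrite /glue restr_off// addr0. Qed.

Lemma glue_out J p q z : measures_on (cells J) q -> z \notin cells J ->
  glue J p q z = p z.
Proof.
move=> [_ q0] zJ; rewrite /glue q0// add0r /restriction.
by move: zJ; rewrite !inE => ->.
Qed.

Lemma block_glue J p q : measures p -> measures_on (cells J) q ->
  block (cells J) p (glue J p q).
Proof.
move=> pm qJ; split=> z; last exact: glue_out.
by rewrite addr_ge0 ?qJ.1// /restriction; case: ifP.
Qed.

Lemma restriction_measures_on J p : measures p ->
  measures_on (cells J) (restriction p (cells J)).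
Proof.
move=> pm; split=> z; first by rewrite /restriction; case: ifP.
by rewrite /restriction => /negbTE ->.
Qed.

Lemma glue_restriction J p q : block (cells J) p q ->
  glue J p (restriction q (cells J)) = q.
Proof.
move=> [qm qp]; apply/funext => z; have [zJ|zJ] := boolP (z \in cells J).
  by rewrite glue_in// /restriction zJ.
by rewrite glue_out ?qp//; exact: restriction_measures_on.
Qed.

(** Off the cylinder, the transport cost, the entropy and the first divergence
    involve p only, and their contribution is the constant K. The second
    divergence sees both parts through the common marginal on Y. *)
Lemma cell_score_energy J p : measures p -> exists K : R, forall q,
  measures_on (cells J) q ->
  cell_score mu nu c eps phi1 phi2 Xc J
    (margY (restriction p (cylinder (~: composite_cell Xc J)%SET))) q =
  (E (glue J p q) - K)%:E.
Proof.
move=> pm; set r := restriction p _; set S := composite_cell Xc J.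
have rm : measures r by move=> z; rewrite /r /restriction; case: ifP.
exists (pairing c r
  + eps * (\sum_(z | z \notin cells J)
             kl (density r (prod_meas mu nu) z) * prod_meas mu nu z)
  + \sum_(x | x \notin S)
      (fine \o phi1) (density (margX r) mu x) * mu x) => q qJ.
have [qm q0] := qJ.
have mE :
    prod_meas (restriction mu S) nu = restriction (prod_meas mu nu) (cells J).
  apply/funext => -[x y]; rewrite /prod_meas /restriction/= !inE/=.
  by rewrite -/S; case: ifP => // _; rewrite mul0r.
have restr_ac (Z : finType) (A : {pred Z}) (rho sigma : Z -> R) :
    full_support sigma -> (forall z, z \notin A -> rho z = 0) ->
    abs_continuous rho (restriction sigma A).
  move=> sigma0 rho0 z; rewrite /restriction.
  by case: ifPn => [_ /eqP|/rho0//]; rewrite gt_eqF.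
have qX x : x \notin S -> margX q x = 0.
  by move=> xS; apply: big1 => y _; apply: q0.
have rX x : x \in S -> margX r x = 0.
  by move=> xS; apply: big1 => y _; apply: restr_off.
rewrite /cell_score mE KL_fdiv; last first.
  by apply: restr_ac => // z; rewrite mulr_gt0.
rewrite !divergence_fdiv//.
- rewrite -!EFinM -!EFinD; congr (_%:E); rewrite /E /energy.
  have -> : pairing c (glue J p q) = pairing c q + pairing c r.
    by rewrite /pairing -big_split; apply: eq_bigr => z _; rewrite mulrDr.
  have -> : margX (glue J p q) = fun x => margX q x + margX r x.
    by apply/funext => x; rewrite /margX -big_split.
  have -> : margY (glue J p q) = fun y => margY q y + margY r y.
    by apply/funext => y; rewrite /margY -big_split.
  rewrite (fdiv_glue _ _ q0 (fun z => @restr_off J p z)).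
  rewrite (fdiv_glue _ _ qX rX).
  rewrite -/r; ring.
- by move=> y; rewrite addr_ge0// margY_ge0.
- by move=> y; exact: ltW.
- by move=> y /eqP; rewrite gt_eqF.
- by move=> x; exact: margX_ge0.
- by move=> x; rewrite /restriction; case: ifP => // _; exact: ltW.
- exact: restr_ac.
Qed.

Lemma cell_solution_block_min J p b : measures p ->
  block_min E (cells J) p b -> solution J p = restriction b (cells J).
Proof.
move=> pm bmin; have [K KE] := cell_score_energy J pm.
have [sJ smin] : argmin (measures_on (cells J))
    (cell_score mu nu c eps phi1 phi2 Xc J
       (margY (restriction p (cylinder (~: composite_cell Xc J)%SET))))
    (solution J p).
  rewrite /solution /cell_solution.
  apply: (xgetPex (fun=> 0)); exists (restriction b (cells J)).
  have bJ := restriction_measures_on J bmin.1.1.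
  split=> // q qJ; rewrite !KE// lee_fin lerD2r.
  rewrite glue_restriction//; last exact: bmin.1.
  by apply: bmin.2; exact: block_glue.
have gmin : block_min E (cells J) p (glue J p (solution J p)).
  split=> [|q qb]; first exact: block_glue.
  have := smin _ (restriction_measures_on J qb.1).
  rewrite !KE//; last exact: restriction_measures_on qb.1.
  by rewrite lee_fin lerD2r glue_restriction.
have <- := block_min_unique E_midpoint gmin bmin.
apply/funext => z; rewrite /restriction; case: ifPn => [zJ|zJ].
  by rewrite glue_in.
by rewrite sJ.2.
Qed.

(** * The parallel update *)

Local Notation cell_index P := {J : {set I} | J \in P}.

(** Full support of mu turns essentially disjoint basic cells into disjoint
    ones. *)
Lemma composite_cell_partition P x : composite_partition P ->
  exists J : cell_index P,
    forall J' : cell_index P,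
      (x \in composite_cell Xc (val J')) = (J' == J).
Proof.
have [covX disj _] := Xc_partition => partP.
have [i xi] := covX x.
have PJ : finset.pblock P i \in P.
  by rewrite finset.pblock_mem// (finset.cover_partition partP) inE.
exists (exist (fun J => J \in P) _ PJ) => -[J' J'P]; rewrite -val_eqE /=.
have iE j : x \in Xc j -> j = i.
  move=> xj; apply/eqP; apply: contraT => /disj.
  rewrite /mass (bigD1 x)/=; last by rewrite !inE xi xj.
  by move=> /eqP; rewrite gt_eqF// ltr_pwDl// sumr_ge0// => y _; exact: ltW.
have [_ triv _] := and3P partP.
apply/bigcupP/eqP => [[j jJ' /iE ji]|->]; last first.
  exists i => //.
  by rewrite finset.mem_pblock (finset.cover_partition partP) inE.
by rewrite -ji (finset.def_pblock triv J'P jJ').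
Qed.

Context (GetWeights : forall P : {set {set I}},
  plan_family R X Y I P -> plan_family R X Y I P -> weights R I P).
Context (W_unit : weight_function Xc GetWeights).
Context (W_cont : weights_continuous Xc GetWeights).
Context (W_decr : weights_decrease mu nu c eps phi1 phi2 Xc GetWeights).

Local Notation upd P p := (update mu nu c eps phi1 phi2 Xc GetWeights P p).
Local Notation old P p := (current_cells Xc (P := P) p).
Local Notation new P p :=
  (new_cells mu nu c eps phi1 phi2 Xc (P := P) p).

Lemma old_cell_families P p : measures p -> cell_families Xc (old P p).
Proof. by move=> pm J; exact: restriction_measures_on. Qed.

Lemma newE P p (J : cell_index P) : measures p ->
  exists2 b, block_min E (cells (val J)) p b &
    new P p J = restriction b (cells (val J)).
Proof.
move=> pm.
have [b bmin] := block_min_exists E_cvg E_coercive (cells (val J)) pm.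
by exists b => //; exact: cell_solution_block_min.
Qed.

Lemma new_cell_families P p : measures p -> cell_families Xc (new P p).
Proof.
move=> pm J; have [b bmin ->] := newE J pm.
exact: restriction_measures_on bmin.1.1.
Qed.

Lemma updateE P p : composite_partition P -> measures p ->
  forall z, exists J : cell_index P, z \in cells (val J) /\
    upd P p z = (1 - GetWeights (old P p) (new P p) J) * p z
                + GetWeights (old P p) (new P p) J * new P p J z.
Proof.
move=> partP pm z; have [J JP] := composite_cell_partition z.1 partP.
have zJ (J' : cell_index P) : (z \in cells (val J')) = (J' == J).
  by rewrite -JP !inE.
have zJin : z \in cells (val J) by rewrite zJ.
exists J; split=> //.
rewrite /update (bigD1 J)//= [X in _ + X]big1 => [|J' J'J].
  have oldE : old P p J z = p z by exact: restriction_in zJin.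
  by rewrite addr0 oldE.
have zJ' : z \notin cells (val J') by rewrite zJ.
rewrite (old_cell_families pm J').2// mulr0.
by rewrite (new_cell_families pm J').2// mulr0 addr0.
Qed.

Lemma update_measures P p : composite_partition P -> measures p ->
  measures (upd P p).
Proof.
move=> partP pm z; have [J [_ ->]] := updateE partP pm z.
have /andP[w0 w1] :=
  W_unit partP (old_cell_families pm) (new_cell_families pm) J.
rewrite addr_ge0// mulr_ge0// ?subr_ge0//.
by have [n0 _] := new_cell_families pm J; exact: n0.
Qed.

(** Each coordinate belongs to a block over which p is minimal. *)
Lemma fixed_optimal P p : composite_partition P -> measures p ->
  (forall J : cell_index P, old P p J = new P p J) -> block_min E predT p p.
Proof.
move=> partP pm fix_p.
apply: (coordinate_min_global mu_gt0 nu_gt0 eps_gt0 f1P f2P) => // z.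
have [J JP] := composite_cell_partition z.1 partP.
have zJ : z \in cells (val J) by have := JP J; rewrite eqxx !inE.
have [b [[bm bp] bmin] newb] := newE J pm.
have bE : b = p.
  apply/funext => z'; have [z'J|/bp//] := boolP (z' \in cells (val J)).
  have := fix_p J; rewrite newb => /(congr1 (@^~ z')).
  by rewrite /current_cells !(restriction_in _ z'J).
subst b; split; first by split.
move=> q [qm qp]; apply: bmin; split=> // z' z'J; apply: qp.
by rewrite inE; apply: contraNneq z'J => ->.
Qed.

Lemma update_le P p : composite_partition P -> measures p ->
  E (upd P p) <= E p /\ (E (upd P p) = E p -> block_min E predT p p).
Proof.
move=> partP pm.
have [fix_p|not_fix] :=
  pselect (forall J : cell_index P, old P p J = new P p J).
  split; last by move=> _; exact: fixed_optimal fix_p.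
  suff -> : upd P p = p by [].
  apply/funext => z; have [J [zJ ->]] := updateE partP pm z.
  have oldE : old P p J z = p z by exact: restriction_in zJ.
  by rewrite -fix_p oldE; ring.
have := W_decr pm partP not_fix.
rewrite !score_energy//; last exact: update_measures.
by rewrite lte_fin => lt; split; [exact: ltW|move=> e; rewrite e ltxx in lt].
Qed.

(** The two ingredients of a step, cell minimisers and weights, are continuous;
    the energy bound keeps the minimisers in a bounded set. *)
Lemma update_cvg P (U : set_system nat) (u : nat -> X * Y -> R) p M :
  UltraFilter U -> composite_partition P ->
  (forall k, measures (u k)) -> (forall k, E (u k) <= M) -> measures p ->
  (forall z, u k z @[k --> U] --> p z) ->
  forall z, upd P (u k) z @[k --> U] --> upd P p z.
Proof.
move=> UU partP um uM pm up.
have new_cvg (J : cell_index P) z : new P (u k) J z @[k --> U] --> new P p J z.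
  have [b bP] := choice (fun k => let: ex_intro2 b h1 h2 := newE J (um k) in
    ex_intro (fun b => block_min E (cells (val J)) (u k) b /\
      new P (u k) J = restriction b (cells (val J))) b (conj h1 h2)).
  have [q [qmin bq]] :=
    block_min_cvg E_cvg E_coercive UU um uM (fun k => (bP k).1) pm up.
  have -> : new P p J = restriction q (cells (val J)).
    exact: cell_solution_block_min.
  have -> : (fun k => new P (u k) J z) =
      (fun k => restriction (b k) (cells (val J)) z).
    by apply/funext => k; rewrite (bP k).2.
  have [zJ|zJ] := boolP (z \in cells (val J)).
    rewrite (restriction_in _ zJ).
    by under eq_cvg do rewrite (restriction_in _ zJ); exact: bq.
  rewrite (restriction_out _ zJ).
  by under eq_cvg do rewrite (restriction_out _ zJ); exact: cvg_cst.
have old_cvg (J : cell_index P) z : old P (u k) J z @[k --> U] --> old P p J z.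
  rewrite /current_cells; have [zJ|zJ] := boolP (z \in cells (val J)).
    rewrite (restriction_in _ zJ).
    by under eq_cvg do rewrite (restriction_in _ zJ); exact: up.
  rewrite (restriction_out _ zJ).
  by under eq_cvg do rewrite (restriction_out _ zJ); exact: cvg_cst.
have fam_cvg : (old P (u k), new P (u k)) @[k --> U] --> (old P p, new P p).
  have old_fam : (old P (u k) : plan_family R X Y I P) @[k --> U] -->
      (old P p : plan_family R X Y I P).
    by apply: cvg_ptws => J; apply: cvg_ptws => z; exact: old_cvg.
  have new_fam : (new P (u k) : plan_family R X Y I P) @[k --> U] -->
      (new P p : plan_family R X Y I P).
    by apply: cvg_ptws => J; apply: cvg_ptws => z; exact: new_cvg.
  exact: cvg_pair old_fam new_fam.
have W_cvg (J : cell_index P) :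
    GetWeights (old P (u k)) (new P (u k)) J @[k --> U] -->
    GetWeights (old P p) (new P p) J.
  have /subspace_continuousP/(_ (old P p, new P p)) := W_cont partP.
  have pF : cell_families Xc (old P p) /\ cell_families Xc (new P p).
    by split; [exact: old_cell_families|exact: new_cell_families].
  move=> /(_ pF) Wc.
  apply: (@cvg_ptws_at _ _ _ _
    (fun k => GetWeights (old P (u k)) (new P (u k)))).
  apply: (cvg_comp (fun k => (old P (u k), new P (u k))) _ _ Wc).
  move=> A /fam_cvg; apply: (@filterS _ U) => k; apply.
  by split; [exact: old_cell_families|exact: new_cell_families].
move=> z; apply: cvg_sumr => J; apply: cvgD.
  apply: cvgM; last exact: old_cvg.
  by apply: cvgB; [exact: cvg_cst|exact: W_cvg].
by apply: cvgM; [exact: W_cvg|exact: new_cvg].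
Qed.

Lemma argmin_score p : block_min E predT p p ->
  argmin measures (score mu nu c eps phi1 phi2) = [set p : plan R X Y].
Proof.
move=> pmin; have pm := pmin.1.1; apply/seteqP; split=> [q [qm qmin]|_ ->].
  apply: (block_min_unique E_midpoint _ pmin); split; first by split.
  move=> r [rm _]; have := qmin r rm.
  by rewrite !score_energy.
split=> // q qm; rewrite !score_energy// lee_fin.
by apply: pmin.2; split.
Qed.

Lemma iterates_cvg JA JB p0 :
  composite_partition JA -> composite_partition JB -> measures p0 ->
  exists pmin : plan R X Y,
    argmin measures (score mu nu c eps phi1 phi2) = [set pmin] /\
    iterates mu nu c eps phi1 phi2 Xc GetWeights JA JB p0 k
      @[k --> \oo] --> pmin.
Proof.
move=> partA partB p0m.
pose s k := iterates mu nu c eps phi1 phi2 Xc GetWeights JA JB p0 k.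
have part k : composite_partition (if odd k then JA else JB) by case: ifP.
have sm k : measures (s k) by elim: k => // k IH; exact: update_measures.
have sdecr k : E (s k.+1) <= E (s k) by have [] := update_le (part k.+1) (sm k).
have sM k : E (s k) <= E p0 by elim: k => // k; exact: le_trans.
have [pmin pminP] := block_min_exists E_cvg E_coercive predT p0m.
have pminE p : block_min E predT p p -> p = pmin.
  move=> [[pm _] pP]; apply: (block_min_unique E_midpoint _ pminP).
  split; first by split.
  by move=> q [qm _]; apply: pP; split.
have pmin_self : block_min E predT pmin pmin.
  have [[pm _] pP] := pminP; split; first by split.
  by move=> q [qm _]; apply: pP; split.
exists pmin; split; first exact: argmin_score.
apply: cvg_ptws => z.
apply: (cvg_to_minimiser E_cvg E_coercive E_midpoint sm sdecr pminP).
move=> U p UU sU pm sp.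
exists (upd JA p); last first.
  by move=> Ep; apply: pminE; apply: (update_le partA pm).2.
have sS k : s k.*2.+1 = upd JA (s k.*2) by rewrite /s /= odd_double.
move=> z'; under eq_cvg do rewrite sS.
exact: (update_cvg UU partA (fun k => sm k.*2) (fun k => sM k.*2) pm sp).
Qed.

End Score.

Theorem proposition3p11 (R : realType) (X Y I : finType)
  (mu : X -> R) (nu : Y -> R) (c : X * Y -> R) (eps : R)
  (phi1 phi2 : R -> \bar R)
  (Xc : I -> {set X}) (JA JB : {set {set I}}) (pi_init : X * Y -> R)
  (GetWeights : forall P : {set {set I}},
     plan_family R X Y I P -> plan_family R X Y I P -> weights R I P)
  (hmu : measures mu) (hmu_supp : full_support mu)
  (hnu : measures nu) (hnu_supp : full_support nu)
  (heps : 0 < eps)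
  (hphi1 : entropy_function phi1) (hphi2 : entropy_function phi2)
  (hphi1_ge0 : forall x : R, (0 <= phi1 x)%E)
  (hphi2_ge0 : forall x : R, (0 <= phi2 x)%E)
  (hphi1_fin : forall x : R, 0 <= x -> (phi1 x < +oo)%E)
  (hphi2_fin : forall x : R, 0 <= x -> (phi2 x < +oo)%E)
  (hphi1_C1 : C1_on_interior phi1) (hphi2_C1 : C1_on_interior phi2)
  (hXc : basic_partition mu Xc)
  (hJA : composite_partition JA) (hJB : composite_partition JB)
  (hinit : measures pi_init)
  (hinit_feas : (score mu nu c eps phi1 phi2 pi_init < +oo)%E)
  (hW : weight_function Xc GetWeights)
  (hW_cont : weights_continuous Xc GetWeights)
  (hW_decr : weights_decrease mu nu c eps phi1 phi2 Xc GetWeights) :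
  exists pi_opt : plan R X Y,
    argmin measures (score mu nu c eps phi1 phi2) = [set pi_opt] /\
    iterates mu nu c eps phi1 phi2 Xc GetWeights JA JB pi_init k
      @[k --> \oo] --> pi_opt.
Proof.
exact: iterates_cvg.
Qed.
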